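(* Let $f\in\mathbb{R}[x_1,\ldots,x_n]$, let $S\subset\mathbb{R}^n$ be a locally closed basic semialgebraic set, and let $\bar x\in S$. If $\bar x$ is a local minimizer of $f$ over $S$, then for every critical direction $u\in T_S(\bar x)$ and every $w\in T^2_S(\bar x;u)$, $$Q_f(\bar x;u,w):=\nabla f(\bar x)w+u^T\nabla^2f(\bar x)u\ge0.$$ If $S$ is algebraically parabolically regular at $(\bar x,u)$, then it is enough to test all $w\in\mathcal{L}^2_S(\bar x;u)$; that is, for such $u$ the condition $Q_f(\bar x;u,w)\ge0$ for all $w\in T^2_S(\bar x;u)$ is equivalent to $Q_f(\bar x;u,w)\ge0$ for all $w\in\mathcal{L}^2_S(\bar x;u)$.
   Context: Bouligand tangent cone: $T_S(\bar x)=\{u\in\mathbb{R}^n:\exists t_k\downarrow 0,\ \exists u_k\to u \text{ with } \bar x+t_ku_k\in S\text{ for all }k\}$ ($t_k\downarrow0$ means $t_k>0$, $t_k\to0$). A direction $u\in T_S(\bar x)$ is critical for $f$ at $\bar x$ if $\nabla f(\bar x)u=0$. $T^2_S(\bar x;u)$ is the (outer) parabolic second-order tangent set: all $w\in\mathbb{R}^n$ such that there exist $t_k\downarrow0$ and $w_k\to w$ with $\bar x+t_ku+\tfrac12t_k^2w_k\in S$ for all $k$. Whenever $\mathcal{L}^2_S$ or algebraic parabolic regularity is used, $S$ is described near $\bar x$ by polynomials as $\{x:g(x)=0,\ h(x)\le0\}$, $g=(g_1,\ldots,g_r)$, $h=(h_1,\ldots,h_s)$. Put $I(\bar x)=\{j:h_j(\bar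 x)=0\}$ and $I_0(\bar x;u)=\{j\in I(\bar x):\nabla h_j(\bar x)u=0\}$. Then $\mathcal{L}^2_S(\bar x;u)$ is the set of $w\in\mathbb{R}^n$ with $Dg(\bar x)w+D^2g(\bar x)[u,u]=0$ and $\nabla h_j(\bar x)w+u^T\nabla^2h_j(\bar x)u\le0$ for all $j\in I_0(\bar x;u)$, where $D^2g(\bar x)[u,u]=(u^T\nabla^2g_i(\bar x)u)_{i=1}^r$. Algebraic parabolic regularity at $(\bar x,u)$ means both of the following. (1) Directional rank stability: with $\mathcal{A}_0(\bar x;u)=\{g_1,\ldots,g_r\}\cup\{h_j:j\in I_0(\bar x;u)\}$, there exist a neighborhood $U$ of $\bar x$, a conic neighborhood $V$ of $u$, and an integer $\rho$ such that for every feasible arc $\gamma$ (a continuous curve $\gamma:(0,\varepsilon)\to S$) with $\gamma(t)=\bar x+tv+O(t^2)$, $v\in V$, whose points lie in $U$ and whose first-order active set $\{j\in I(\bar x):\nabla h_j(\bar x)v=0\}$ equals $I_0(\bar x;u)$, the matrix of gradients of the functions in $\mathcal{A}_0(\bar x;u)$ has rank $\rho$ at $\gamma(t)$ for all sufficiently small $t>0$. (2) Parabolic arc-realizability: for every $w\in\mathcal{L}^2_S(\bar x;u)$ there exists a semialgebraic arc $\gamma:(0,\varepsilon)\to S$ with $\gamma(t)=\bar x+tu+\tfrac12t^2w+o(t^2)$ as $t\downarrow0$. *)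

(* Defs.v *)
From HB Require Import structures.
From mathcomp Require Import all_boot all_order all_algebra.
From mathcomp Require Import all_classical all_reals all_analysis.
(* The notations of mpoly clash with those of MathComp-Analysis. *)
From mathcomp Require Import -(notations) mpoly.

Set Implicit Arguments.
Unset Strict Implicit.
Unset Printing Implicit Defensive.

Import Order.TTheory GRing.Theory Num.Theory numFieldNormedType.Exports.

Local Open Scope classical_set_scope.
Local Open Scope ring_scope.

Notation "{ 'mpoly' T [ n ] }" := (mpoly n T)
  (at level 0, T, n at level 2, format "{ 'mpoly'  T [ n ] }") : type_scope.

Definition peval (R : realType) (n : nat) (p : {mpoly R[n]}) (x : 'cV[R]_n) : R :=
  meval (fun i => x i 0) p.

Definition grad (R : realType) (n : nat) (p : {mpoly R[n]}) (x : 'cV[R]_n) :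
    'rV[R]_n :=
  \row_i peval (mderiv i p) x.

Definition hess (R : realType) (n : nat) (p : {mpoly R[n]}) (x : 'cV[R]_n) :
    'M[R]_n :=
  \matrix_(i, j) peval (mderiv j (mderiv i p)) x.

Definition jac (R : realType) (n r : nat) (g : 'I_r -> {mpoly R[n]})
    (x : 'cV[R]_n) : 'M[R]_(r, n) :=
  \matrix_i grad (g i) x.

Definition dir1 (R : realType) (n : nat) (p : {mpoly R[n]}) (x v : 'cV[R]_n) : R :=
  (grad p x *m v) 0 0.

Definition dir2 (R : realType) (n : nat) (p : {mpoly R[n]}) (x u : 'cV[R]_n) : R :=
  (u^T *m hess p x *m u) 0 0.

Definition Qf (R : realType) (n : nat) (f : {mpoly R[n]}) (x u w : 'cV[R]_n) : R :=
  dir1 f x w + dir2 f x u.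

(* Equations, weak inequalities and strict inequalities may all occur. *)
Definition basic_semialgebraic (R : realType) (n : nat) (A : set 'cV[R]_n) : Prop :=
  exists (r s q : nat) (g : 'I_r -> {mpoly R[n]}) (h : 'I_s -> {mpoly R[n]})
    (p : 'I_q -> {mpoly R[n]}),
    A = [set x | [/\ forall i, peval (g i) x = 0,
                     forall j, peval (h j) x <= 0 &
                     forall k, peval (p k) x < 0]].

Definition semialgebraic (R : realType) (n : nat) (A : set 'cV[R]_n) : Prop :=
  exists (k : nat) (B : 'I_k -> set 'cV[R]_n),
    (forall i, basic_semialgebraic (B i)) /\ A = \bigcup_i B i.

Definition locally_closed (T : topologicalType) (A : set T) : Prop :=
  exists U F : set T, [/\ open U, closed F & A = U `&` F].

Definition described_near (R : realType) (n r s : nat) (S : set 'cV[R]_n)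
    (g : 'I_r -> {mpoly R[n]}) (h : 'I_s -> {mpoly R[n]}) (xbar : 'cV[R]_n) : Prop :=
  \forall x \near xbar,
    S x <-> (forall i, peval (g i) x = 0) /\ (forall j, peval (h j) x <= 0).

Definition local_minimizer (R : realType) (n : nat) (f : {mpoly R[n]})
    (S : set 'cV[R]_n) (xbar : 'cV[R]_n) : Prop :=
  S xbar /\ \forall x \near xbar, S x -> peval f xbar <= peval f x.

Definition tangent_cone (R : realType) (n : nat) (S : set 'cV[R]_n)
    (xbar : 'cV[R]_n) : set 'cV[R]_n :=
  [set u | exists (t : nat -> R) (v : nat -> 'cV[R]_n),
    [/\ forall k, 0 < t k, t @ \oo --> (0 : R), v @ \oo --> u &
        forall k, S (xbar + t k *: v k)]].

Definition critical_direction (R : realType) (n : nat) (f : {mpoly R[n]})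
    (S : set 'cV[R]_n) (xbar u : 'cV[R]_n) : Prop :=
  tangent_cone S xbar u /\ dir1 f xbar u = 0.

Definition tangent2 (R : realType) (n : nat) (S : set 'cV[R]_n)
    (xbar u : 'cV[R]_n) : set 'cV[R]_n :=
  [set w | exists (t : nat -> R) (v : nat -> 'cV[R]_n),
    [/\ forall k, 0 < t k, t @ \oo --> (0 : R), v @ \oo --> w &
        forall k, S (xbar + t k *: u + (2^-1 * t k ^+ 2) *: v k)]].

Definition active_first_order (R : realType) (n s : nat)
    (h : 'I_s -> {mpoly R[n]}) (xbar u : 'cV[R]_n) : {set 'I_s} :=
  [set j : 'I_s | (peval (h j) xbar == 0) && (dir1 (h j) xbar u == 0)]%SET.

Definition linearized2 (R : realType) (n r s : nat)
    (g : 'I_r -> {mpoly R[n]}) (h : 'I_s -> {mpoly R[n]})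
    (xbar u : 'cV[R]_n) : set 'cV[R]_n :=
  [set w | jac g xbar *m w + \col_i dir2 (g i) xbar u = 0 /\
           forall j, j \in active_first_order h xbar u ->
             dir1 (h j) xbar w + dir2 (h j) xbar u <= 0].

(* Arcs are total functions on R; only their values on ]0, eps[ matter. *)
Definition feasible_arc (R : realType) (n : nat) (S : set 'cV[R]_n) (eps : R)
    (gamma : R -> 'cV[R]_n) : Prop :=
  [/\ 0 < eps, {within `]0, eps[, continuous gamma} &
      forall t : R, 0 < t < eps -> S (gamma t)].

Definition semialgebraic_arc (R : realType) (n : nat) (S : set 'cV[R]_n) (eps : R)
    (gamma : R -> 'cV[R]_n) : Prop :=
  feasible_arc S eps gamma /\
  semialgebraic ((fun t : R => col_mx t%:M (gamma t)) @` `]0, eps[).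

Definition conic_nbhs (R : realType) (n : nat) (u : 'cV[R]_n)
    (V : set 'cV[R]_n) : Prop :=
  nbhs u V /\ forall (c : R) v, 0 < c -> V v -> V (c *: v).

(* Row j of the lower block is the gradient of the j-th element of
   [enum J], so only the inequalities indexed by J contribute. *)
Definition active_jac (R : realType) (n r s : nat)
    (g : 'I_r -> {mpoly R[n]}) (h : 'I_s -> {mpoly R[n]}) (J : {set 'I_s})
    (x : 'cV[R]_n) : 'M[R]_(r + #|J|, n) :=
  col_mx (jac g x) (jac (fun k : 'I_#|J| => h (enum_val k)) x).

Definition directional_rank_stability (R : realType) (n r s : nat)
    (S : set 'cV[R]_n) (g : 'I_r -> {mpoly R[n]}) (h : 'I_s -> {mpoly R[n]})
    (xbar u : 'cV[R]_n) : Prop :=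
  exists (U V : set 'cV[R]_n) (rho : nat),
    [/\ nbhs xbar U, conic_nbhs u V &
      forall (eps : R) (gamma : R -> 'cV[R]_n) (v : 'cV[R]_n),
        feasible_arc S eps gamma ->
        V v ->
        (fun t : R => gamma t - (xbar + t *: v)) =O_ (0^'+) (fun t : R => t ^+ 2) ->
        (forall t : R, 0 < t < eps -> U (gamma t)) ->
        active_first_order h xbar v = active_first_order h xbar u ->
        \forall t \near 0^'+,
          \rank (active_jac g h (active_first_order h xbar u) (gamma t)) = rho].

Definition parabolic_arc_realizability (R : realType) (n r s : nat)
    (S : set 'cV[R]_n) (g : 'I_r -> {mpoly R[n]}) (h : 'I_s -> {mpoly R[n]})
    (xbar u : 'cV[R]_n) : Prop :=
  forall w, linearized2 g h xbar u w ->
    exists (eps : R) (gamma : R -> 'cV[R]_n),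
      semialgebraic_arc S eps gamma /\
      (fun t : R => gamma t - (xbar + t *: u + (2^-1 * t ^+ 2) *: w))
        =o_ (0^'+) (fun t : R => t ^+ 2).

Definition algebraically_parabolically_regular (R : realType) (n r s : nat)
    (S : set 'cV[R]_n) (g : 'I_r -> {mpoly R[n]}) (h : 'I_s -> {mpoly R[n]})
    (xbar u : 'cV[R]_n) : Prop :=
  directional_rank_stability S g h xbar u /\
  parabolic_arc_realizability S g h xbar u.

(* Main.v *)
Require Import Defs.
From HB Require Import structures.
From mathcomp Require Import all_boot all_order all_algebra.
From mathcomp Require Import all_classical all_reals all_analysis.
From mathcomp Require Import -(notations) mpoly.
From mathcomp Require Import ring lra.

Set Implicit Arguments.
Unset Strict Implicit.
Unset Printing Implicit Defensive.

Import Order.TTheory GRing.Theory Num.Theory numFieldNormedType.Exports.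

Local Open Scope classical_set_scope.
Local Open Scope ring_scope.

(** The whole argument rests on a second-order expansion along parabolic
sequences.  If t_k tends to 0 and v_k tends to w, then for every polynomial p

  p (x + t_k u + t_k^2/2 v_k) = p x + t_k (grad p x u) + t_k^2/2 e_k,

where e_k tends to Q_p(x; u, w) = grad p x w + u^T (hess p x) u
([parabolic_taylor]).  Instead of estimating a remainder, one observes that the
polynomials having such an expansion contain the constants and the coordinates
and are stable under sums and products.

Divided by the right power of t_k, the expansion turns a sign of
p (x_k) - p x into a sign of Q_p as soon as grad p x u = 0
([parabolic_Qf_ge0], [parabolic_Qf_le0]), and p (x_k) = p x = 0 forces
grad p x u = 0 ([parabolic_dir1_eq0]).  Applied to the objective f at a local
minimizer this is the necessary condition.  Applied to the constraints it shows
that every parabolic tangent direction satisfies the linearized second-order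
system ([tangent2_sub_linearized2]).  Conversely, sampling the arc given by
arc-realizability along a sequence of times tending to 0 exhibits each solution
of the linearized system as a parabolic tangent direction
([linearized2_sub_tangent2]).  So under regularity both sets of directions
coincide, and testing Q_f on either is the same condition. *)

(** * Directional derivatives as derivations of the polynomial ring *)

(** Having the directional derivative as a polynomial, rather than as the number
[dir1 p x u], lets it be iterated: [dir1] and [dir2] are the values of its first
and second iterates, and their product rules follow from [mdirderivM]. *)
Definition mdirderiv (R : realType) (n : nat) (u : 'cV[R]_n) (p : {mpoly R[n]}) :
    {mpoly R[n]} :=
  \sum_i u i 0 *: mderiv i p.

Lemma mdirderivD (R : realType) (n : nat) (u : 'cV[R]_n) (p q : {mpoly R[n]}) :
  mdirderiv u (p + q) = mdirderiv u p + mdirderiv u q.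
Proof.
by rewrite /mdirderiv -big_split; apply: eq_bigr => i _; rewrite mderivD scalerDr.
Qed.

Lemma mdirderivM (R : realType) (n : nat) (u : 'cV[R]_n) (p q : {mpoly R[n]}) :
  mdirderiv u (p * q) = mdirderiv u p * q + p * mdirderiv u q.
Proof.
rewrite /mdirderiv mulr_suml mulr_sumr -big_split; apply: eq_bigr => i _ /=.
by rewrite mderivM scalerDr scalerAl scalerAr.
Qed.

Lemma mdirderivC (R : realType) (n : nat) (u : 'cV[R]_n) (c : R) :
  mdirderiv u (mpolyC n c) = 0.
Proof. by rewrite /mdirderiv big1 // => i _; rewrite mderivC scaler0. Qed.

Lemma mdirderivXU (R : realType) (n : nat) (u : 'cV[R]_n) (i : 'I_n) :
  mdirderiv u (mpolyX R (mnm1 i)) = mpolyC n (u i 0).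
Proof.
rewrite /mdirderiv (bigD1 i) //= big1 ?addr0 => [|j neq_ji].
  rewrite mderivX mnm1E eqxx scale1r.
  suff -> : mnm_sub (mnm1 i) (mnm1 i) = mnm0 by rewrite mpolyX0 -alg_mpolyC.
  by apply/mnmP => j; rewrite mnmBE mnm0E subnn.
by rewrite mderivX mnm1E eq_sym (negbTE neq_ji) scale0r scaler0.
Qed.

Lemma peval_mdirderiv (R : realType) (n : nat) (u x : 'cV[R]_n)
    (p : {mpoly R[n]}) :
  peval (mdirderiv u p) x = dir1 p x u.
Proof.
rewrite /peval /mdirderiv /dir1 mxE raddf_sum; apply: eq_bigr => i _ /=.
by rewrite mevalZ mxE mulrC.
Qed.

Lemma peval_mdirderiv2 (R : realType) (n : nat) (u x : 'cV[R]_n)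
    (p : {mpoly R[n]}) :
  peval (mdirderiv u (mdirderiv u p)) x = dir2 p x u.
Proof.
rewrite peval_mdirderiv /dir1 /dir2 -mulmxA !mxE.
under eq_bigr => j _ do
  rewrite mxE /peval /mdirderiv (big_morph _ (mderivD _) (mderiv0 _ _))
    (big_morph _ (mevalD _) (meval0 _)) mulr_suml.
rewrite exchange_big /=; apply: eq_bigr => i _.
rewrite !mxE mulr_sumr; apply: eq_bigr => j _.
by rewrite mderivZ mevalZ !mxE mulrA.
Qed.

(** Polynomials are generated as a ring by the constants and the variables; this
is the form of induction suited to properties stable under products, whereas
[mpolyind] asks for a multiple of an arbitrary monomial at each step. *)
Lemma mpoly_alg_ind (R : realType) (n : nat) (P : {mpoly R[n]} -> Prop) :
  (forall c, P (mpolyC n c)) -> (forall i, P (mpolyX R (mnm1 i))) ->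
  (forall p q, P p -> P q -> P (p + q)) ->
  (forall p q, P p -> P q -> P (p * q)) ->
  forall p, P p.
Proof.
move=> PC PX PD PM p; have P1 : P 1 by rewrite -mpolyC1.
rewrite (mpolyE p); apply: (big_ind P); [by rewrite -mpolyC0|exact: PD|].
move=> m _; rewrite -mul_mpolyC mpolyXE_id; apply: (PM _ _ (PC _)).
apply: (big_ind P) => // i _; elim: (m i) => [|k IHk]; first by rewrite expr0.
by rewrite exprS; apply: PM.
Qed.

(** * Expansion along parabolic sequences *)

Lemma dir1N (R : realType) (n : nat) (p : {mpoly R[n]}) (x v : 'cV[R]_n) :
  dir1 (- p) x v = - dir1 p x v.
Proof.
have gradN : grad (- p) x = - grad p x.
  by apply/rowP => i; rewrite !mxE mderivN /peval mevalN.
by rewrite /dir1 gradN mulNmx mxE.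
Qed.

Lemma QfN (R : realType) (n : nat) (p : {mpoly R[n]}) (x u w : 'cV[R]_n) :
  Qf (- p) x u w = - Qf p x u w.
Proof.
have hessN : hess (- p) x = - hess p x.
  by apply/matrixP => i j; rewrite !mxE !mderivN /peval mevalN.
by rewrite /Qf /dir2 dir1N hessN mulmxN mulNmx mxE opprD.
Qed.

Definition parabola (R : realType) (n : nat) (x u : 'cV[R]_n) (t : R)
    (v : 'cV[R]_n) : 'cV[R]_n :=
  x + t *: u + (2^-1 * t ^+ 2) *: v.

Lemma cvg_parabola (R : realType) (n : nat) (x u w : 'cV[R]_n)
    (t : nat -> R) (v : nat -> 'cV[R]_n) :
  t @ \oo --> (0 : R) -> v @ \oo --> w ->
  (fun k => parabola x u (t k) (v k)) @ \oo --> x.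
Proof.
move=> t0 vw.
have tu : (fun k => t k *: u) @ \oo --> (0 : R) *: u.
  exact: cvgZ t0 (cvg_cst u).
have tv : (fun k => (2^-1 * (t k * t k)) *: v k) @ \oo --> (2^-1 * (0 * 0) : R) *: w.
  exact: cvgZ (cvgM (cvg_cst _) (cvgM t0 t0)) vw.
have -> : x = x + (0 : R) *: u + (2^-1 * (0 * 0) : R) *: w.
  by rewrite !mulr0 !scale0r !addr0.
have -> : (fun k => parabola (x + 0 *: u + (2^-1 * (0 * 0)) *: w) u (t k) (v k)) =
          (fun k => x + t k *: u + (2^-1 * (t k * t k)) *: v k).
  by apply/funext => k; rewrite /parabola expr2 !mulr0 !scale0r !addr0.
exact: cvgD (cvgD (cvg_cst x) tu) tv.
Qed.

(** The induction is on the ring structure of polynomials.  In a product of two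
expansions a + t b + t^2/2 e and a' + t b' + t^2/2 e', the coefficient of
t^2/2 is 2 b b' + a e' + a' e up to terms that carry a factor t; in the limit
it is the product rule for Q, the cross term 2 b b' coming from the second
derivative. *)
Lemma parabolic_taylor (R : realType) (n : nat) (x u w : 'cV[R]_n)
    (t : nat -> R) (v : nat -> 'cV[R]_n) (p : {mpoly R[n]}) :
  t @ \oo --> (0 : R) -> v @ \oo --> w ->
  exists e : nat -> R, e @ \oo --> Qf p x u w /\
    forall k, peval p (parabola x u (t k) (v k))
              = peval p x + t k * dir1 p x u + 2^-1 * t k ^+ 2 * e k.
Proof.
move=> t0 vw; rewrite /Qf -peval_mdirderiv2 -!peval_mdirderiv.
elim/mpoly_alg_ind: p =>
  [c|i|p q [e [le ee]] [e' [le' ee']]|p q [e [le ee]] [e' [le' ee']]].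
- (* [mdirderivC] also rewrites the outer derivative: 0 unifies with the
     constant polynomial 0. *)
  exists (fun=> 0); rewrite !mdirderivC /peval !meval0 addr0.
  by split=> [|k]; [exact: cvg_cst|rewrite !mevalC !mulr0 !addr0].
- exists (fun k => v k i 0); rewrite !mdirderivXU mdirderivC /peval meval0 mevalC addr0.
  split=> [|k]; last by rewrite !mevalXU mevalC !mxE.
  exact: (cvg_comp _ _ vw (@coord_continuous _ _ _ i 0 w)).
- exists (fun k => e k + e' k); rewrite !mdirderivD /peval !mevalD -!/(peval _ _).
  split=> [|k]; first by rewrite addrACA; exact: cvgD le le'.
  by rewrite mevalD -!/(peval _ _) ee ee'; ring.
rewrite !(mdirderivM, mdirderivD) /peval !(mevalM, mevalD) -!/(peval _ _).
set l := (X in e @ _ --> X) in le; set l' := (X in e' @ _ --> X) in le'.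
set a := peval p x in ee *; set a' := peval q x in ee' *.
set b := peval (mdirderiv u p) x in ee *; set b' := peval (mdirderiv u q) x in ee' *.
exists (fun k => 2 * b * b' + a * e' k + a' * e k +
   t k * (b * e' k + b' * e k + 2^-1 * (t k * (e k * e' k)))).
split=> [|k]; last by rewrite mevalM -!/(peval _ _) ee ee'; field.
have limD (s s' : nat -> R) (y y' : R) : s @ \oo --> y -> s' @ \oo --> y' ->
    (fun k => s k + s' k) @ \oo --> y + y' by exact: cvgD.
have limM (s s' : nat -> R) (y y' : R) : s @ \oo --> y -> s' @ \oo --> y' ->
    (fun k => s k * s' k) @ \oo --> y * y' by exact: cvgM.
have limZ (c : R) (s : nat -> R) (y : R) :
    s @ \oo --> y -> (fun k => c * s k) @ \oo --> c * y.
  exact: cvgMl_tmp.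
have limC (c : R) : (fun=> c : R) @ \oo --> c by exact: cvg_cst.
have second := limD _ _ _ _ (limD _ _ _ _ (limC (2 * b * b')) (limZ a _ _ le'))
                    (limZ a' _ _ le).
have third := limM _ _ _ _ t0 (limD _ _ _ _
  (limD _ _ _ _ (limZ b _ _ le') (limZ b' _ _ le))
  (limZ 2^-1 _ _ (limM _ _ _ _ t0 (limM _ _ _ _ le le')))).
have := limD _ _ _ _ second third; rewrite mul0r addr0.
move=> lim; rewrite [X in _ --> X](_ : _ = 2 * b * b' + a * l' + a' * l).
  exact: lim.
by rewrite /l /l'; clearbody a a' b b'; ring.
Qed.

(** Dividing 0 = t_k (grad p x u) + t_k^2/2 e_k by t_k leaves
grad p x u = - t_k e_k / 2, which tends to 0. *)
Lemma parabolic_dir1_eq0 (R : realType) (n : nat) (x u w : 'cV[R]_n)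
    (t : nat -> R) (v : nat -> 'cV[R]_n) (p : {mpoly R[n]}) :
  (forall k, 0 < t k) -> t @ \oo --> (0 : R) -> v @ \oo --> w ->
  peval p x = 0 -> (\forall k \near \oo, peval p (parabola x u (t k) (v k)) = 0) ->
  dir1 p x u = 0.
Proof.
move=> t_gt0 t0 vw p0 pxi; have [e [le ee]] := parabolic_taylor x u p t0 vw.
have s0 : (fun k => - 2^-1 * (t k * e k)) @ \oo --> - 2^-1 * (0 * Qf p x u w).
  exact: cvgM (cvg_cst _) (cvgM t0 le).
rewrite mul0r mulr0 in s0; apply: cvg_unique s0 => //.
apply: cvg_near_cst; near=> k.
have : peval p (parabola x u (t k) (v k)) = 0 by near: k.
rewrite ee p0 add0r expr2 => E; apply: (mulfI (lt0r_neq0 (t_gt0 k))).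
by move: E; lra.
Unshelve. all: by end_near. Qed.

(** Without first-order term, p (x_k) - p x = t_k^2/2 e_k, so each e_k is
nonnegative and so is its limit. *)
Lemma parabolic_Qf_ge0 (R : realType) (n : nat) (x u w : 'cV[R]_n)
    (t : nat -> R) (v : nat -> 'cV[R]_n) (p : {mpoly R[n]}) :
  (forall k, 0 < t k) -> t @ \oo --> (0 : R) -> v @ \oo --> w ->
  dir1 p x u = 0 ->
  (\forall k \near \oo, peval p x <= peval p (parabola x u (t k) (v k))) ->
  0 <= Qf p x u w.
Proof.
move=> t_gt0 t0 vw p1 pxi; have [e [le ee]] := parabolic_taylor x u p t0 vw.
apply: (@closed_cvg _ _ \oo _ e [set y | 0 <= y] (@closed_ge _ 0) _ _ le).
near=> k; have : peval p x <= peval p (parabola x u (t k) (v k)) by near: k.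
rewrite ee p1 mulr0 addr0 lerDl pmulr_rge0 //.
by rewrite mulr_gt0 ?invr_gt0 ?exprn_gt0.
Unshelve. all: by end_near. Qed.

Lemma parabolic_Qf_le0 (R : realType) (n : nat) (x u w : 'cV[R]_n)
    (t : nat -> R) (v : nat -> 'cV[R]_n) (p : {mpoly R[n]}) :
  (forall k, 0 < t k) -> t @ \oo --> (0 : R) -> v @ \oo --> w ->
  dir1 p x u = 0 ->
  (\forall k \near \oo, peval p (parabola x u (t k) (v k)) <= peval p x) ->
  Qf p x u w <= 0.
Proof.
move=> t_gt0 t0 vw p1 pxi; rewrite -oppr_ge0 -QfN.
apply: (parabolic_Qf_ge0 t_gt0 t0 vw); first by rewrite dir1N p1 oppr0.
by apply: filterS pxi => k; rewrite /peval !mevalN lerN2.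
Qed.

(** * Parabolic tangent directions and the linearized system *)

(** For an equation, the first-order condition grad g x u = 0 needed by the sign
lemmas comes from the parabolic sequence itself; for an inequality it is part
of the definition of [active_first_order]. *)
Lemma tangent2_sub_linearized2 (R : realType) (n r s : nat) (S : set 'cV[R]_n)
    (g : 'I_r -> {mpoly R[n]}) (h : 'I_s -> {mpoly R[n]}) (xbar u : 'cV[R]_n) :
  S xbar -> described_near S g h xbar ->
  tangent2 S xbar u `<=` linearized2 g h xbar u.
Proof.
move=> Sx Sgh w [t [v [t_gt0 t0 vw Sxi]]].
have [gx _] : (forall i, peval (g i) xbar = 0) /\ (forall j, peval (h j) xbar <= 0).
  exact/(nbhs_singleton Sgh).
have xi_gh : \forall k \near \oo,
    (forall i, peval (g i) (parabola xbar u (t k) (v k)) = 0) /\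
    (forall j, peval (h j) (parabola xbar u (t k) (v k)) <= 0).
  near=> k; have [Sg _] : S (parabola xbar u (t k) (v k)) <->
      (forall i, peval (g i) (parabola xbar u (t k) (v k)) = 0) /\
      (forall j, peval (h j) (parabola xbar u (t k) (v k)) <= 0).
    by near: k; exact: (cvg_parabola u t0 vw Sgh).
  exact: Sg (Sxi k).
split=> [|j].
  apply/colP => i; rewrite !mxE.
  have g1 : dir1 (g i) xbar u = 0.
    by apply: (parabolic_dir1_eq0 t_gt0 t0 vw (gx i)); apply: filterS xi_gh => k [].
  have -> : \sum_j jac g xbar i j * w j 0 = dir1 (g i) xbar w.
    by rewrite /dir1 mxE; apply: eq_bigr => j _; rewrite !mxE.
  apply/le_anti/andP; split.
    apply: (parabolic_Qf_le0 t_gt0 t0 vw g1).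
    by apply: filterS xi_gh => k [-> _]; rewrite gx.
  apply: (parabolic_Qf_ge0 t_gt0 t0 vw g1).
  by apply: filterS xi_gh => k [-> _]; rewrite gx.
rewrite inE => /andP[/eqP hj0 /eqP hj1].
by apply: (parabolic_Qf_le0 t_gt0 t0 vw hj1); apply: filterS xi_gh => k [_]; rewrite hj0.
Unshelve. all: by end_near. Qed.

(** The arc is sampled at times t_k, and v_k is defined by solving
gamma (t_k) = xbar + t_k u + t_k^2/2 v_k.  The error o(t^2) of the arc, divided
by t_k^2/2, is exactly v_k - w. *)
Lemma linearized2_sub_tangent2 (R : realType) (n r s : nat) (S : set 'cV[R]_n)
    (g : 'I_r -> {mpoly R[n]}) (h : 'I_s -> {mpoly R[n]}) (xbar u : 'cV[R]_n) :
  parabolic_arc_realizability S g h xbar u ->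
  linearized2 g h xbar u `<=` tangent2 S xbar u.
Proof.
move=> realizable w /realizable[eps [gamma [[[eps_gt0 _ Sgamma] _] /eqoP gamma_w]]].
(* The factor 1/2 keeps the times strictly below eps, since harmonic 0 = 1. *)
pose t k : R := 2^-1 * eps * harmonic k.
have t_gt0 k : 0 < t k by rewrite !mulr_gt0 ?invr_gt0 ?harmonic_gt0.
have t_lt k : t k < eps.
  have : harmonic k <= 1 :> R by rewrite /harmonic invf_le1 // ler1n.
  rewrite /t; nra.
have t0 : t @ \oo --> (0 : R).
  rewrite -[0](mulr0 (2^-1 * eps)); apply: cvgM; first exact: cvg_cst.
  exact: cvg_harmonic.
have t0r : t @ \oo --> 0^'+.
  move=> A A0; change (\forall k \near \oo, A (t k)).
  near=> k; have : 0 < t k -> A (t k) by near: k; exact: t0 A0.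
  exact.
have sq_gt0 k : 0 < 2^-1 * t k ^+ 2 by rewrite mulr_gt0 ?invr_gt0 ?exprn_gt0.
pose v k := (2^-1 * t k ^+ 2)^-1 *: (gamma (t k) - (xbar + t k *: u)).
have vE k : xbar + t k *: u + (2^-1 * t k ^+ 2) *: v k = gamma (t k).
  by rewrite /v scalerA divff ?gt_eqF // scale1r subrKC.
exists t, v; split=> // [|k]; last by rewrite vE; apply: Sgamma; rewrite t_gt0 t_lt.
apply/cvgrPdist_le => e e_gt0; near=> k.
(* The tolerance e / 2 absorbs the factor 2 coming from dividing by t_k^2/2. *)
have gk : `|gamma (t k) - (xbar + t k *: u + (2^-1 * t k ^+ 2) *: w)|
    <= e / 2 * `|t k ^+ 2|.
  near: k; exact: t0r _ (gamma_w _ (divr_gt0 e_gt0 (ltr0Sn _ 1))).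
move: gk; rewrite -vE opprD addrACA subrr add0r -scalerBr normrZ.
rewrite !ger0_norm ?sqr_ge0 ?(ltW (sq_gt0 k)) // -(distrC w).
rewrite [e / 2 * _](_ : _ = 2^-1 * t k ^+ 2 * e); last by ring.
by rewrite ler_pM2l.
Unshelve. all: by end_near. Qed.

Theorem theorem6p1 (R : realType) (n : nat) (f : {mpoly R[n]})
    (S : set 'cV[R]_n) (xbar : 'cV[R]_n)
    (S_basic : basic_semialgebraic S) (S_lc : locally_closed S)
    (S_xbar : S xbar) :
  (local_minimizer f S xbar ->
     forall u, critical_direction f S xbar u ->
     forall w, tangent2 S xbar u w -> 0 <= Qf f xbar u w) /\
  (forall (r s : nat) (g : 'I_r -> {mpoly R[n]}) (h : 'I_s -> {mpoly R[n]}),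
     described_near S g h xbar ->
     forall u, critical_direction f S xbar u ->
     algebraically_parabolically_regular S g h xbar u ->
     (forall w, tangent2 S xbar u w -> 0 <= Qf f xbar u w) <->
     (forall w, linearized2 g h xbar u w -> 0 <= Qf f xbar u w)).
Proof.
split=> [[_ f_min] u [_ f1] w [t [v [t_gt0 t0 vw Sxi]]]|r s g h Sgh u _ [_ real_u]].
  apply: (parabolic_Qf_ge0 t_gt0 t0 vw f1).
  near=> k; have min_k : S (parabola xbar u (t k) (v k)) ->
      peval f xbar <= peval f (parabola xbar u (t k) (v k)).
    by near: k; exact: (cvg_parabola u t0 vw f_min).
  exact: min_k (Sxi k).
split=> Qf_ge0 w w_in; apply: Qf_ge0.
  exact: linearized2_sub_tangent2 w_in.
exact: (tangent2_sub_linearized2 S_xbar Sgh).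
Unshelve. all: by end_near. Qed.
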